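(* For every $n\geq 1$, the multivariate polynomial $$B_n(\mathbf{x},\mathbf{y},\mathbf{z},\mathbf{u},\mathbf{v})=\sum_{\pi\in L_n}\prod_{i\in X(\pi)}x_{\pi_i}\prod_{i\in Y(\pi)}y_{\pi_i}\prod_{i\in Z(\pi)}z_{\pi_i}\prod_{i\in U(\pi)}u_{\pi_i}\prod_{i\in V(\pi)}v_{\pi_i}$$ is stable.
   Context: A polynomial $f\in\mathbb{C}[z_1,\ldots,z_m]$ is called stable if $f(z_1,\ldots,z_m)\neq 0$ whenever $\mathrm{Im}(z_i)>0$ for all $i$. For $n\geq 1$ let $M_n$ be the multiset $\{1,1,\bar 1,2,2,\bar 2,\ldots,n,n,\bar n\}$. Comparisons ($<$, $\leq$, $>$) between entries, barred or not, are made by numerical value, so that $\bar k$ and $k$ have the same value $k$. A Legendre-Stirling permutation of $M_n$ is a permutation $\pi=\pi_1\pi_2\cdots\pi_{3n}$ of the multiset $M_n$ such that whenever $i<j<k$ and $\pi_i$ and $\pi_k$ are the two copies of the same unbarred element, then $\pi_j>\pi_i$ (in value, hence strictly). $L_n$ denotes the set of Legendre-Stirling permutations of $M_n$. For $\pi\in L_n$ set $\pi_0=\pi_{3n+1}=0$ and define subsets of $\{1,\ldots,3n\}$: $X(\pi)=\{i : \pi_{i-1}\leq\pi_i,\ \pi_i \text{ is unbarred and appears for the first time}\}$, $Y(\pi)=\{i : \pi_i>\pi_{i+1},\ \pi_i\text{ is unbarred}\}$, $Z(\pi)=\{i : \pi_{i-1}\leq\pi_i,\ \pi_i\text{ is unbarred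 and appears for the second time}\}$, $U(\pi)=\{i : \pi_{i-1}\leq\pi_i,\ \pi_i\text{ is barred}\}$, $V(\pi)=\{i : \pi_i>\pi_{i+1},\ \pi_i\text{ is barred}\}$. Here ''first/second time'' refers to reading $\pi$ from left to right. When $\pi_i=\bar k$, the variables $u_{\pi_i},v_{\pi_i}$ mean $u_k,v_k$. The $x_i,y_i,z_i,u_i,v_i$ are independent commuting variables. *)

(* Defs.v *)
From HB Require Import structures.
From mathcomp Require Import all_boot all_order all_algebra.
From mathcomp Require Import reals complex mpoly.

Set Implicit Arguments.
Unset Strict Implicit.
Unset Printing Implicit Defensive.

Import GRing.Theory Num.Theory.
Local Open Scope ring_scope.

Definition stable (R : realType) (m : nat) (f : {mpoly R[i][m]}) : Prop :=
  forall z : 'I_m -> R[i], (forall i, 0 < complex.Im (z i)) -> f.@[z] <> 0.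

(** Letters: [(false, k)] is the unbarred element of value [k.+1] and
    [(true, k)] the barred one. *)
Definition letter (n : nat) : finType := (bool * 'I_n)%type.

Definition barred (n : nat) (a : letter n) : bool := a.1.

Definition value (n : nat) (a : letter n) : nat := (a.2 : nat).+1.

Definition Mn (n : nat) : seq (letter n) :=
  flatten [seq [:: (false, k); (false, k); (true, k)] | k <- enum 'I_n].

Definition word (n : nat) : finType := (3 * n).-tuple (letter n).

Definition legendre_stirling (n : nat) (p : word n) : bool :=
  perm_eq p (Mn n) &&
  [forall i : 'I_(3 * n), forall j : 'I_(3 * n), forall k : 'I_(3 * n),
     [&& (i < j)%N, (j < k)%N, ~~ barred (tnth p i) & tnth p i == tnth p k]
     ==> (value (tnth p i) < value (tnth p j))%N].

Definition Ln (n : nat) : {set word n} := [set p | legendre_stirling p].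

(** The values [p_0 = 0, p_1, ..., p_3n, p_(3n+1) = 0].  Positions are
    numbered from 0 in ['I_(3 * n)], so [i : 'I_(3 * n)] stands for the
    1-based position [i.+1]. *)
Definition padded (n : nat) (p : word n) : seq nat := 0%N :: rcons [seq value a | a <- p] 0%N.

Definition weak_ascent_at (n : nat) (p : word n) (i : 'I_(3 * n)) : bool :=
  (nth 0%N (padded p) i <= nth 0%N (padded p) i.+1)%N.

Definition descent_at (n : nat) (p : word n) (i : 'I_(3 * n)) : bool :=
  (nth 0%N (padded p) i.+1 > nth 0%N (padded p) i.+2)%N.

Definition occurrence (n : nat) (p : word n) (i : 'I_(3 * n)) : nat :=
  (count_mem (tnth p i) (take i p)).+1.

Definition Xset (n : nat) (p : word n) : {set 'I_(3 * n)} :=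
  [set i | [&& weak_ascent_at p i, ~~ barred (tnth p i) & occurrence p i == 1%N]].

Definition Yset (n : nat) (p : word n) : {set 'I_(3 * n)} :=
  [set i | descent_at p i && ~~ barred (tnth p i)].

Definition Zset (n : nat) (p : word n) : {set 'I_(3 * n)} :=
  [set i | [&& weak_ascent_at p i, ~~ barred (tnth p i) & occurrence p i == 2%N]].

Definition Uset (n : nat) (p : word n) : {set 'I_(3 * n)} :=
  [set i | weak_ascent_at p i && barred (tnth p i)].

Definition Vset (n : nat) (p : word n) : {set 'I_(3 * n)} :=
  [set i | descent_at p i && barred (tnth p i)].

(** The [5 * n] variables, in five families of [n], are indexed through the
    bijection [mxvec_index : 'I_5 -> 'I_n -> 'I_(5 * n)].  The variable
    attached to a letter depends only on its value. *)
Definition var (R : realType) (n : nat) (c : 'I_5) (a : letter n) :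
  {mpoly R[i][5 * n]} := 'X_(mxvec_index c a.2).

Definition xvar (R : realType) n := @var R n (inord 0%N).
Definition yvar (R : realType) n := @var R n (inord 1%N).
Definition zvar (R : realType) n := @var R n (inord 2%N).
Definition uvar (R : realType) n := @var R n (inord 3%N).
Definition vvar (R : realType) n := @var R n (inord 4%N).

Definition Bn (R : realType) (n : nat) : {mpoly R[i][5 * n]} :=
  \sum_(p in Ln n)
    (\prod_(i in Xset p) xvar R (tnth p i)) *
    (\prod_(i in Yset p) yvar R (tnth p i)) *
    (\prod_(i in Zset p) zvar R (tnth p i)) *
    (\prod_(i in Uset p) uvar R (tnth p i)) *
    (\prod_(i in Vset p) vvar R (tnth p i)).

(* Main.v *)
(** A word of [L_(n+1)] arises uniquely from one of [L_n] by inserting the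
    barred letter [n+1] into a gap and then the adjacent pair of unbarred
    letters [n+1] into a gap.  Each of the [3n+1] gaps of a word carries exactly
    one variable, so [B_n] is a sum of products over gaps, and insertion into a
    gap becomes differentiation: with [P(t) = B_n(c + t)],
      [B_(n+1)(c) = x z u (v y P''(0) + (v + y) P'(0)) = x z u Q'(0)],
      [Q(t) = (v + t) (y + t) P'(t)],
    where [x, ..., v] are the values of the new variables.  If all of them lie
    in the upper half plane, then [P], hence [P'] by Gauss-Lucas, hence [Q], has
    no root in the closed upper half plane, and Gauss-Lucas again gives
    [Q'(0) <> 0]. *)

Require Import Defs.
From mathcomp Require Import all_boot all_order all_algebra.
From mathcomp Require Import reals complex mpoly ring zify.
Set Implicit Arguments.
Unset Strict Implicit.
Unset Printing Implicit Defensive.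
Import Order.TTheory GRing.Theory Num.Theory.
Local Open Scope ring_scope.

(** * Gauss-Lucas for the closed upper half plane *)

Section GaussLucas.
Variable R : realType.
Implicit Types (z t : R[i]) (p : {poly R[i]}).

Definition upper_free p := forall t, 0 <= complex.Im t -> ~~ root p t.

Lemma ImD z t : complex.Im (z + t) = complex.Im z + complex.Im t.
Proof. by case: z; case: t. Qed.

Lemma Im_inv_lt0 z : 0 < complex.Im z -> complex.Im z^-1 < 0.
Proof.
case: z => a b /= b0.
rewrite oppr_lt0 divr_gt0 //.
by rewrite ltr_wpDl ?sqr_ge0 ?exprn_gt0.
Qed.

(** The logarithmic derivative is the sum of [(t - r)^-1] over the roots, and each term has negative
    imaginary part. The empty list is set apart because strictness fails only there. *)
Lemma Im_logderiv_le0 (rs : seq R[i]) t :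
    (forall r, r \in rs -> complex.Im r < complex.Im t) ->
  let q := \prod_(r <- rs) ('X - r%:P) in
  q.[t] != 0 /\ (if rs is [::] then q^`().[t] = 0
                    else complex.Im (q^`().[t] / q.[t]) < 0).
Proof.
elim: rs => [|r rs IH] rs_lt /=.
  by rewrite big_nil derivC !hornerC oner_eq0.
have {IH} [x xrs | q_neq0 q_le] := IH; first by rewrite rs_lt // inE xrs orbT.
have tr_gt0 : 0 < complex.Im (t - r).
  rewrite ImD; case: r rs_lt => a b /(_ (a +i* b)%C); rewrite inE eqxx /= => H.
  by rewrite subr_gt0 H.
have tr_neq0 : t - r != 0 by apply: contraTneq tr_gt0 => ->; rewrite ltxx.
rewrite big_cons hornerM !hornerE mulf_neq0 //; split=> //.
set q := \prod_(_ <- _) _ in q_neq0 q_le *.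
have -> : (('X - r%:P) * q)^`().[t] / ((t - r) * q.[t])
          = (t - r)^-1 + q^`().[t] / q.[t].
  rewrite derivM derivXsubC !hornerE.
  by field; rewrite tr_neq0 q_neq0.
rewrite ImD ltr_wnDr ?Im_inv_lt0 //.
by case: (rs) q_le => [->|_ _ /ltW //]; rewrite mul0r.
Qed.

(** All roots of [p] lie strictly below the real axis, hence below [t], so the logarithmic
    derivative at [t] has negative imaginary part and cannot vanish. *)
Lemma upper_free_deriv p :
  (1 < size p)%N -> upper_free p -> upper_free p^`().
Proof.
move=> szp pfree t t_ge0.
have [rs p_rs] := closed_field_poly_normal p.
have lp_neq0 : lead_coef p != 0 by rewrite lead_coef_eq0 -size_poly_gt0 ltnW.
have rs_root r : r \in rs -> root p r.
  by rewrite p_rs rootZ // root_prod_XsubC.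
have [r r_rs | q_neq0 q_le] := @Im_logderiv_le0 rs t.
  rewrite (lt_le_trans _ t_ge0) // ltNge; apply/negP => /pfree /negP; apply.
  exact: rs_root.
(* Without roots [p] would be constant, against [szp]. *)
case: rs => [|r rs] in p_rs rs_root q_neq0 q_le *.
  by move: szp; rewrite p_rs big_nil alg_polyC size_polyC lp_neq0.
rewrite p_rs derivZ rootZ // /root; apply: contraTneq q_le => ->.
by rewrite mul0r ltxx.
Qed.

End GaussLucas.

(** * Monomials, derivations and substitution of one factor *)

Section Weights.
Variables (A : comNzRingType) (T : eqType).
Implicit Types (c d : T -> A) (g l r : seq T).

Definition wt c g : A := \prod_(w <- g) c w.

(** The value at [c] of the derivation of the polynomial ring sending the
    variable [w] to [d w], applied to the monomial [g]. *)
Fixpoint der c d g : A :=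
  if g is w :: g' then d w * wt c g' + c w * der c d g' else 0.

Lemma wt_cons c w g : wt c (w :: g) = c w * wt c g.
Proof. exact: big_cons. Qed.

Lemma wt_cat c l r : wt c (l ++ r) = wt c l * wt c r.
Proof. exact: big_cat. Qed.

Lemma der_cat c d l r :
  der c d (l ++ r) = der c d l * wt c r + wt c l * der c d r.
Proof.
elim: l => [|w l IH] /=; first by rewrite /wt big_nil; ring.
by rewrite IH wt_cat wt_cons; ring.
Qed.

Lemma eq_in_der c d d' g : {in g, d =1 d'} -> der c d g = der c d' g.
Proof.
elim: g => //= w g IH dd'; rewrite dd' ?mem_head // IH // => x xg.
by rewrite dd' // inE xg orbT.
Qed.

Lemma der_cst c e g : der c (fun=> e) g = e * der c (fun=> 1) g.
Proof. by elim: g => [|w g IH] /=; [rewrite mulr0 | rewrite IH; ring]. Qed.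

(** This is the Leibniz rule: each term replaces a single factor [w] of the monomial by its image,
    the monomial of [f w]. *)
Lemma sum_wt_subst c (f : T -> seq T) w0 g :
  \sum_(j <- iota 0 (size g)) wt c (take j g ++ f (nth w0 g j) ++ drop j.+1 g)
  = der c (fun w => wt c (f w)) g.
Proof.
elim: g => [|w g IH] /=; first by rewrite big_nil.
rewrite big_cons /= drop0 wt_cat; congr (_ + _).
rewrite (iotaDl 1) big_map -IH mulr_sumr; apply: eq_bigr => j _.
by rewrite /= wt_cons.
Qed.

End Weights.

(** The point [c] moved along the all-ones direction with parameter ['X]; differentiating at 0 then
    sums all partial derivatives at [c]. *)
Definition shift (A : comNzRingType) (T : Type) (c : T -> A) (w : T) : {poly A} :=
  (c w)%:P + 'X.

Section Shift.
Variables (A : comNzRingType) (T : eqType).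
Implicit Types (c : T -> A) (g : seq T).

Lemma horner_wt_shift c g t :
  (wt (shift c) g).[t] = wt (fun w => c w + t) g.
Proof.
by rewrite horner_prod; apply: eq_bigr => w _; rewrite /shift !hornerE.
Qed.

Lemma horner_wt_shift0 c g : (wt (shift c) g).[0] = wt c g.
Proof. by rewrite horner_wt_shift; apply: eq_bigr => w _; rewrite addr0. Qed.

Lemma deriv_wt_shift c g :
  (wt (shift c) g)^`() = der (shift c) (fun=> 1) g.
Proof.
elim: g => [|w g IH] /=; first by rewrite /wt big_nil derivC.
by rewrite wt_cons derivM IH /shift derivD derivC derivX add0r.
Qed.

Lemma horner_deriv_wt_shift0 c g :
  (wt (shift c) g)^`().[0] = der c (fun=> 1) g.
Proof.
rewrite deriv_wt_shift; elim: g => [|w g IH] /=; first by rewrite hornerC.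
by rewrite !hornerE IH horner_wt_shift0.
Qed.

End Shift.

(** * Gap labels of a word and their change under insertion *)

(** A letter [(barred, value)] with value at least 1; the sentinel plays the
    part of [p_0] and [p_(3n+1)]. *)
Notation nletter := (bool * nat)%type.
Notation sentinel := (true, 0%N).

Definition ins (T : Type) (x s : seq T) (i : nat) := take i s ++ x ++ drop i s.

(** [again] tells whether the letter [b] occurs again further right, i.e.
    whether an unbarred [b] is a first copy.  The label [(f, k)] stands for the
    variable of family [f], in the order x, y, z, u, v, and value [k]. *)
Definition gap (a b : nletter) (again : bool) : nat * nat :=
  if (a.2 <= b.2)%N then ((if b.1 then 3 else if again then 0 else 2)%N, b.2)
  else ((if a.1 then 4 else 1)%N, a.2).

(** The letter [a] to the left of [s] is a parameter so that insertion can be studied by induction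
    on [s]. *)
Fixpoint gaps (a : nletter) (s : seq nletter) :=
  if s is b :: s' then gap a b (b \in s') :: gaps b s'
  else [:: gap a (true, 0%N) false].

Lemma size_gaps a s : size (gaps a s) = (size s).+1.
Proof. by elim: s a => //= b s IH a; rewrite IH. Qed.

Lemma mem_ins (T : eqType) (x s : seq T) i : ins x s i =i x ++ s.
Proof.
move=> y; rewrite /ins -{3}(cat_take_drop i s) !mem_cat.
by rewrite orbCA.
Qed.

Lemma gaps_insS a b x s i :
  gaps a (ins x (b :: s) i.+1) = gap a b (b \in x ++ s) :: gaps b (ins x s i).
Proof. by rewrite -(mem_ins x s i). Qed.

(** A new strict maximum is preceded by an ascent and followed by a descent, so the label of the gap
    it splits gives way to [u] and [v] of value [n]. *)
Lemma gaps_ins_barred n a s i :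
    (a.2 < n)%N -> all (fun b => b.2 < n)%N s -> (i <= size s)%N ->
  gaps a (ins [:: (true, n)] s i)
  = take i (gaps a s) ++ [:: (3, n); (4, n)]%N ++ drop i.+1 (gaps a s).
Proof.
elim: s a i => [|b s IH] a [|i] // an.
- by move=> _ _; rewrite /gap /= /gap (ltnW an) /= leqn0; case: n an.
- by case/andP=> bn sn _; rewrite /= /gap /= (ltnW an) leqNgt bn /= drop0.
case/andP=> bn sn i_le; rewrite gaps_insS IH //= inE.
(* The head is smaller than the new letter, hence different from it, and keeps its [again] flag. *)
by case: eqP bn => [->|] //=; rewrite ltnn.
Qed.

Lemma gap_eq_u a b again n :
  (gap a b again == (3, n)%N) = (a.2 <= b.2)%N && (b == (true, n)).
Proof.
rewrite /gap; case: leqP => _; case: b => -[] k; rewrite !xpair_eqE //=.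
all: by [case: again | case: (a.1)].
Qed.

(** The gap labelled [(3, n)] is the one just before the barred [n]; a pair put
    there is followed by a weak ascent, hence the case distinction. *)
Lemma gaps_ins_pair n w0 a t j :
    (0 < n)%N -> (a.2 <= n)%N ->
    all (fun b => (b.2 <= n)%N && (b != (false, n))) t -> (j <= size t)%N ->
  gaps a (ins [:: (false, n); (false, n)] t j)
  = take j (gaps a t)
    ++ [:: (0, n); (2, n);
           if nth w0 (gaps a t) j == (3, n) then (3, n) else (1, n)]%N
    ++ drop j.+1 (gaps a t).
Proof.
move=> n0; elim: t a j => [|b t IH] a [|j] // an.
- move=> _ _; rewrite /= gap_eq_u xpair_eqE /= (ltn_eqF n0) andbF.
  by rewrite /gap /= an inE eqxx /= leqnn leqn0 (gtn_eqF n0).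
- case/andP=> /andP[bn b_neq] tn _; rewrite /= gap_eq_u drop0.
  have nt : (false, n) \in t = false.
    by apply/negP => /(allP tn); rewrite eqxx andbF.
  rewrite /gap /= an !inE eqxx nt orbF /= leqnn eq_sym (negPf b_neq).
  (* The letter after the pair is either smaller, giving the descent label [(1, n)], or the barred
     [n], giving the weak ascent label [(3, n)]. *)
  case: b bn b_neq => b k /=; case: (ltngtP k n) => // [kn|->] _.
    by rewrite [X in _ && X]xpair_eqE (ltn_eqF kn) !andbF.
  by case: b; rewrite ?an ?eqxx.
case/andP=> /andP[bn b_neq] tn j_le; rewrite gaps_insS IH //=.
by rewrite !inE (negPf b_neq).
Qed.

(** The barred letter goes in first: put in after the pair, it would have to avoid the gap between
    the two copies, whereas in this order every gap is allowed. *)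
Fixpoint lswords n : seq (seq nletter) :=
  if n is m.+1 then
    [seq ins [:: (false, n); (false, n)] t j
       | t <- [seq ins [:: (true, n)] s i
                 | s <- lswords m, i <- iota 0 (size s).+1],
         j <- iota 0 (size t).+1]
  else [:: [::]].

Lemma size_ins (T : Type) (x s : seq T) i : size (ins x s i) = (size x + size s)%N.
Proof. by rewrite /ins !size_cat addnCA -size_cat cat_take_drop. Qed.

Lemma lswordsSP n s :
  s \in lswords n.+1 <->
  exists s' i j, [/\ s' \in lswords n, (i <= size s')%N, (j <= (size s').+1)%N &
    s = ins [:: (false, n.+1); (false, n.+1)] (ins [:: (true, n.+1)] s' i) j].
Proof.
split=> [/flatten_mapP[t /flatten_mapP[s' s's /mapP[i ilt ->]] /mapP[j jlt ->]]
        |[s' [i [j [s's ile jle ->]]]]].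
  exists s', i, j; move: ilt jlt; rewrite !mem_iota !add0n !ltnS size_ins.
  by split.
apply/flatten_mapP; exists (ins [:: (true, n.+1)] s' i).
  by apply/flatten_mapP; exists s' => //; rewrite map_f // mem_iota.
by rewrite map_f // mem_iota size_ins.
Qed.

Lemma all_ins (T : eqType) (P : pred T) (x s : seq T) i :
  all P (ins x s i) = all P x && all P s.
Proof. by rewrite -all_cat; apply: eq_all_r; apply: mem_ins. Qed.

Lemma sum_lswordsS (V : nmodType) n (G : seq nletter -> V) :
  \sum_(s <- lswords n.+1) G s
  = \sum_(s <- lswords n) \sum_(i <- iota 0 (size s).+1)
      \sum_(j <- iota 0 (size s).+2)
        G (ins [:: (false, n.+1); (false, n.+1)] (ins [:: (true, n.+1)] s i) j).
Proof.
rewrite big_flatten big_map big_flatten big_map.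
apply: eq_bigr => s _; rewrite big_map; apply: eq_bigr => i _.
by rewrite big_map size_ins.
Qed.

Lemma lswords_bound n s b :
  s \in lswords n -> b \in s -> (0 < b.2 <= n)%N.
Proof.
elim: n s b => [|n IH] s b /=; first by rewrite inE => /eqP ->.
move=> /lswordsSP[s' [i [j [s's _ _ ->]]]].
rewrite mem_ins mem_cat mem_ins mem_cat !inE orbb.
case/or3P=> [/eqP->|/eqP->|/(IH _ _ s's)]; rewrite ?leqnn //.
by case/andP=> -> /leqW.
Qed.

(** * The gap polynomial: recurrence and nonvanishing *)

Definition Fpoly (A : comNzRingType) n (c : nat * nat -> A) : A :=
  \sum_(s <- lswords n) wt c (gaps sentinel s).

Lemma gaps_bound n a s :
  (a.2 <= n)%N -> all (fun b => b.2 <= n)%N s ->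
  all (fun w => w.2 <= n)%N (gaps a s).
Proof.
elim: s a => [|b s IH] a an /=.
  by rewrite /gap andbT /=; case: ifP.
by case/andP=> bn sn; rewrite IH // andbT /gap; case: ifP.
Qed.

(** The barred letter turns a gap variable into [u * v]. The pair then acts as the derivation
    sending [u] to [x * z * u] and every other gap variable to [x * z * y]. Applied to [u * v * m],
    with [m] the remaining monomial, it gives [x * z * u] times [(v + y) * m + v * y * D m], where
    [D] sums the partial derivatives. *)
Lemma Fpoly_rec (A : comNzRingType) n (c : nat * nat -> A) :
  let P := Fpoly n (shift c) in
  let: (x, y, z, u, v) :=
    (c (0, n.+1), c (1, n.+1), c (2, n.+1), c (3, n.+1), c (4, n.+1))%N in
  Fpoly n.+1 c
  = x * z * u * (v * y * P^`()^`().[0] + (v + y) * P^`().[0]).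
Proof.
set P := Fpoly n _ => /=.
set x := c (0, _)%N; set y := c (1, _)%N; set z := c (2, _)%N.
set u := c (3, _)%N; set v := c (4, _)%N.
rewrite /Fpoly sum_lswordsS.
have -> : P^`() = \sum_(s <- lswords n) (wt (shift c) (gaps sentinel s))^`().
  exact: raddf_sum.
rewrite raddf_sum !horner_sum !mulr_sumr -big_split mulr_sumr.
apply: eq_big_seq => s s_ls.
have sn : all (fun b => b.2 < n.+1)%N s.
  by apply/allP => b /(lswords_bound s_ls) /andP[].
set g := gaps sentinel s.
have gn : all (fun w => w.2 <= n)%N g by apply: gaps_bound.
(* Old labels have value at most [n], so only the new barred letter yields the exceptional label. *)
have gu w : w \in g -> (w == (3, n.+1)%N) = false.
  by case: w => i k /(allP gn) /= kn; rewrite xpair_eqE (@ltn_eqF k n.+1 kn) andbF.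
rewrite horner_deriv_wt_shift0 (deriv_wt_shift c g).
pose del i := take i g ++ drop i.+1 g.
(* The ring varies because this serves over [A] for the first derivative and over [{poly A}] for the
   second. *)
have sum_del (A' : comNzRingType) (c' : nat * nat -> A') :
    \sum_(i <- iota 0 (size g)) wt c' (del i) = der c' (fun=> 1) g.
  have := sum_wt_subst c' (fun=> [::]) (0, 0)%N g.
  by rewrite /wt big_nil.
rewrite -!sum_del raddf_sum horner_sum !mulr_sumr -big_split mulr_sumr size_gaps.
apply: eq_big_seq => i; rewrite mem_iota add0n ltnS /= => i_le.
rewrite horner_deriv_wt_shift0.
set t := ins [:: (true, _)] s i.
have tn : all (fun b => (b.2 <= n.+1)%N && (b != (false, n.+1))) t.
  rewrite all_ins /= leqnn /=; apply: sub_all sn => -[b k] /= kn.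
  by rewrite (ltnW kn) xpair_eqE (ltn_eqF kn) andbF.
pose f w := [:: (0, n.+1); (2, n.+1);
          if w == (3, n.+1) then (3, n.+1) else (1, n.+1)]%N.
have -> : \sum_(j <- iota 0 (size s).+2)
     wt c (gaps sentinel (ins [:: (false, n.+1); (false, n.+1)] t j))
  = der c (fun w => wt c (f w)) (gaps sentinel t).
  rewrite -(sum_wt_subst c f (0, 0)%N) size_gaps size_ins.
  apply: eq_big_seq => j; rewrite mem_iota add0n ltnS => /= j_le.
  by rewrite (gaps_ins_pair (0, 0)%N) // size_ins.
rewrite gaps_ins_barred // -/g.
(* On old labels the substitution is uniform, so the derivation is a multiple of the sum of partial
   derivatives. *)
have der_f l : {subset l <= g} ->
    der c (fun w => wt c (f w)) l = x * z * y * der c (fun=> 1) l.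
  move=> lg; rewrite -der_cst; apply: eq_in_der => w /lg wg.
  by rewrite /f gu // /wt !big_cons big_nil -/x -/y -/z; ring.
rewrite !der_cat !wt_cat (der_f (take i g)) ?(der_f (drop _ g)); last first.
- by move=> w; apply: mem_take.
- by move=> w; apply: mem_drop.
rewrite /f /= !eqxx /= /wt !big_cons !big_nil -/x -/y -/z -/u -/v.
ring.
Qed.

Lemma horner_Fpoly_shift (A : comNzRingType) n (c : nat * nat -> A) t :
  (Fpoly n (shift c)).[t] = Fpoly n (fun w => c w + t).
Proof.
by rewrite /Fpoly horner_sum; apply: eq_bigr => s _; rewrite horner_wt_shift.
Qed.

(** The empty word has one gap, between two sentinels, whose dummy label [(3, 0)] lets the induction
    start from a nonconstant polynomial. *)
Lemma Fpoly0 (A : comNzRingType) (c : nat * nat -> A) : Fpoly 0 c = c (3, 0)%N.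
Proof. by rewrite /Fpoly /= big_seq1 /wt big_seq1. Qed.

(** The size bound is carried through the induction because Gauss-Lucas requires a nonconstant
    polynomial. *)
Lemma Fpoly_neq0 (R : realType) n (c : nat * nat -> R[i]) :
    (forall w, 0 < complex.Im (c w)) ->
  Fpoly n c != 0 /\ (1 < size (Fpoly n (shift c)))%N.
Proof.
have Im_neq0 (a : R[i]) : 0 < complex.Im a -> a != 0.
  by move=> a0; apply: contraTneq a0 => ->; rewrite ltxx.
elim: n c => [|n IH] c c0.
  by rewrite !Fpoly0 Im_neq0 // /shift addrC size_XaddC.
have F_neq0 (c' : nat * nat -> R[i]) :
    (forall w, 0 < complex.Im (c' w)) -> Fpoly n.+1 c' != 0.
  move=> c'0; rewrite Fpoly_rec.
  set P := Fpoly n _; set v := c' (4, _)%N; set y := c' (1, _)%N.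
  have szP : (1 < size P)%N by case: (IH c' c'0).
  (* Adding [t] with nonnegative imaginary part keeps all values in the upper half plane, so the
     induction hypothesis applies to the translated point. *)
  have freeP : upper_free P.
    move=> t t0; rewrite /root horner_Fpoly_shift; case: (IH (fun w => c' w + t)) => //.
    by move=> w; rewrite ImD ltr_wpDr.
  have freeP' := upper_free_deriv szP freeP.
  pose Q := ('X + v%:P) * ('X + y%:P) * P^`().
  have P'_neq0 : P^`() != 0.
    by apply: contraTneq (freeP' 0 (lexx _)) => ->; rewrite root0.
  have szQ : (1 < size Q)%N.
    have XC_neq0 (a : R[i]) : 'X + a%:P != 0 by rewrite -size_poly_gt0 size_XaddC.
    apply: (@leq_trans (size ('X + v%:P))); first by rewrite size_XaddC.
    rewrite dvdp_leq ?mulf_neq0 //.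
    by rewrite /Q -mulrA dvdp_mulr.
  have freeQ : upper_free Q.
    move=> t t0; rewrite !rootM !negb_or freeP' // andbT.
    have XC_root (a : R[i]) : 0 < complex.Im a -> ~~ root ('X + a%:P) t.
      by move=> a0; rewrite /root !hornerE Im_neq0 // ImD ltr_wpDl.
    by rewrite !XC_root /v /y ?c'0.
  have -> : v * y * P^`()^`().[0] + (v + y) * P^`().[0] = Q^`().[0].
    by rewrite !derivM !derivD !derivX !derivC !hornerE; ring.
  rewrite mulf_neq0 //; first by rewrite !mulf_neq0 ?Im_neq0 ?c'0.
  by have freeQ' := upper_free_deriv szQ freeQ; apply: (freeQ' 0 (lexx _)).
split; first exact: F_neq0.
have nz : Fpoly n.+1 (shift c) != 0.
  apply: contraNneq (F_neq0 c c0) => F0.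
  have <- : (Fpoly n.+1 (shift c)).[0] = Fpoly n.+1 c.
    by rewrite /Fpoly horner_sum; apply: eq_bigr => s _; apply: horner_wt_shift0.
  by rewrite F0 horner0.
(* Over [{poly R[i]}] the recurrence exhibits the factor [shift c (0, n.+1)], of degree 1. *)
move: nz; rewrite Fpoly_rec -!mulrA => nz.
apply: (@leq_trans (size (shift c (0, n.+1)%N))).
  by rewrite /shift addrC size_XaddC.
by rewrite dvdp_leq // dvdp_mulr.
Qed.

(** * The recursively built words are exactly the nested ones, each listed once *)

Definition nested (s : seq nletter) :=
  forall a b, subseq [:: (false, a); b; (false, a)] s -> (a < b.2)%N.

Fixpoint letters n : seq nletter :=
  if n is m.+1 then [:: (false, n), (false, n), (true, n) & letters m] else [::].

Lemma letters_bound n b : b \in letters n -> (0 < b.2 <= n)%N.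
Proof.
elim: n => // n IH; rewrite !inE.
case/or4P=> [/eqP->|/eqP->|/eqP->|/IH]; rewrite ?leqnn //.
by case/andP=> -> /leqW.
Qed.

Lemma perm_ins (T : eqType) (x s : seq T) i : perm_eq (ins x s i) (x ++ s).
Proof. by rewrite /ins perm_catCA cat_take_drop. Qed.

Lemma filter_ins (T : eqType) (P : pred T) (x s : seq T) i :
  all (predC P) x -> all P s -> filter P (ins x s i) = s.
Proof.
move=> /allP xP sP; rewrite /ins !filter_cat.
have -> : filter P x = [::].
  by apply/eqP; rewrite -(negbK (_ == _)) -has_filter -all_predC; apply/allP.
by rewrite /= -filter_cat cat_take_drop; apply/all_filterP.
Qed.

Lemma index_ins (T : eqType) (y : T) (x s : seq T) i :
  y \notin s -> (i <= size s)%N -> index y (ins (y :: x) s i) = i.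
Proof.
move=> ys ile; rewrite /ins index_cat /= eqxx addn0 size_takel //.
by case: ifP => // /mem_take; rewrite (negPf ys).
Qed.

(** A pattern meeting the new letter has it in the middle, since the outer letters are unbarred, and
    it exceeds them; any other pattern already lies in [s]. *)
Lemma nested_ins_barred n s i :
  all (fun b => b.2 < n)%N s -> nested s -> nested (ins [:: (true, n)] s i).
Proof.
move=> sn sLS a b sub.
have sP : all (predC1 (true, n)) s.
  by apply: sub_all sn => -[[] k] //= kn; rewrite xpair_eqE (ltn_eqF kn).
have [b_n | b_neq] := eqVneq b (true, n).
  have : (false, a) \in ins [:: (true, n)] s i by rewrite (mem_subseq sub) ?mem_head.
  by rewrite mem_ins b_n => /(allP sn).
apply: sLS; rewrite -(@filter_ins _ (predC1 (true, n)) [:: (true, n)] s i) //=.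
  by rewrite subseq_filter sub /= b_neq.
by rewrite eqxx.
Qed.

Lemma subseq_cons_cat (T : eqType) (x : T) (s l r : seq T) :
  x \notin l -> subseq (x :: s) (l ++ x :: r) = subseq s r.
Proof.
elim: l => [|y l IH] /=; first by rewrite eqxx.
by rewrite inE negb_or => /andP[/negPf-> /IH].
Qed.

(** The new copies are adjacent and enclose nothing; as a middle letter, [n] exceeds the outer ones,
    which are at most [n] and different from it. *)
Lemma nested_ins_pair n s i :
    all (fun b => (b.2 <= n)%N && (b != (false, n))) s -> nested s ->
  nested (ins [:: (false, n); (false, n)] s i).
Proof.
move=> sn sLS a b sub; set p := (false, n) in sn sub *.
have sP : all (predC1 p) s by apply: sub_all sn => c /andP[].
have ps : p \notin s by apply/negP => /(allP sP); rewrite /= eqxx.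
have [a_n | a_neq] := eqVneq a n.
  move: sub; rewrite a_n /ins subseq_cons_cat; last first.
    by apply: contra ps; apply: mem_take.
  have pd : p \notin drop i s by apply: contra ps; apply: mem_drop.
  rewrite /= -/p; case: eqP => _ /mem_subseq sub.
    by case/negP: pd; apply: sub; rewrite mem_head.
  by case/negP: pd; apply: sub; rewrite !inE eqxx orbT.
have ap : (false, a) != p by rewrite xpair_eqE.
have [b_n | b_neq] := eqVneq b p.
  have : (false, a) \in ins [:: p; p] s i by rewrite (mem_subseq sub) ?mem_head.
  rewrite mem_ins !inE (negPf ap) /= => /(allP sn) /andP[/=].
  by rewrite b_n ltn_neqAle a_neq.
apply: sLS; rewrite -(@filter_ins _ (predC1 p) [:: p; p] s i) //=.
  by rewrite subseq_filter sub /= ap b_neq.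
by rewrite eqxx.
Qed.

Lemma count_letters n f k :
  count_mem (f, k) (letters n) = ((if f then 1 else 2) * (0 < k <= n))%N.
Proof.
elim: n => [|n IH] /=; first by rewrite leqn0; case: k => *; rewrite muln0.
rewrite IH !xpair_eqE; case: (f) => /=; case: (ltngtP k n.+1) => kn //=; lia.
Qed.

(** For the converse, a letter between the two copies of the maximal unbarred letter would exceed
    the maximum, so they are adjacent; removing them and then the barred letter undoes both
    insertions. *)
Lemma mem_lswords n s :
  s \in lswords n <-> perm_eq s (letters n) /\ nested s.
Proof.
elim: n s => [|n IH] s.
  split=> [|[/perm_nilP -> //]]; rewrite inE => /eqP -> //.
set p := (false, n.+1); set q := (true, n.+1).
split=> [/lswordsSP[s' [i [j [s's _ _ ->]]]] | [s_perm sLS]].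
  have [s'_perm s'nested] := (IH s').1 s's.
  have s'n : all (fun b => b.2 < n.+1)%N s'.
    by apply/allP => b /(lswords_bound s's) /andP[].
  split.
    apply: perm_trans (perm_ins _ _ _) _; rewrite /= !perm_cons.
    by apply: perm_trans (perm_ins _ _ _) _; rewrite /= perm_cons.
  apply: nested_ins_pair; last exact: nested_ins_barred.
  rewrite all_ins /= leqnn; apply: sub_all s'n => -[b k] /= kn.
  by rewrite (ltnW kn) xpair_eqE (ltn_eqF kn) andbF.
have [l1 [l2 [l3 s_def]]] : exists l1 l2 l3, s = l1 ++ p :: l2 ++ p :: l3.
  have cnt : count_mem p s = 2%N by rewrite (permP s_perm) count_letters leqnn.
  have ps : p \in s by rewrite (perm_mem s_perm) mem_head.
  case/splitPr def_s: {1}s / ps => [s1 s2].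
  have [ps1 | ps1] := boolP (p \in s1).
    case/splitPr def_s1: {1}s1 / ps1 => [r1 r2]; exists r1, r2, s2.
    by rewrite -catA.
  have [ps2 | ps2] := boolP (p \in s2).
    by case/splitPr def_s2: {1}s2 / ps2 => [r1 r2]; exists s1, r1, r2.
  by move: cnt; rewrite def_s count_cat /= eqxx !(count_memPn _).
have l2_nil : l2 = [::].
  case: l2 s_def => // b l2 s_def.
  have bs : b \in s by rewrite s_def !(mem_cat, inE) eqxx !orbT.
  have sub : subseq [:: p; b; p] s.
    rewrite s_def; apply: subseq_trans (suffix_subseq l1 _); rewrite /= eqxx.
    by rewrite eqxx sub1seq mem_cat mem_head orbT.
  move: bs; rewrite (perm_mem s_perm) => /letters_bound.
  by case/andP=> _; rewrite leqNgt (sLS _ _ sub).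
rewrite {}l2_nil /= in s_def.
have t_perm : perm_eq (l1 ++ l3) (q :: letters n).
  rewrite -(perm_cat2l [:: p; p]); apply: perm_trans s_perm.
  by rewrite s_def (perm_catCA [:: p; p] l1 l3).
have qt : q \in l1 ++ l3 by rewrite (perm_mem t_perm) mem_head.
case/splitPr def_t: {1}(l1 ++ l3) / qt => [r1 r2].
have s'_perm : perm_eq (r1 ++ r2) (letters n).
  rewrite -(perm_cons q); apply: perm_trans t_perm.
  by rewrite def_t perm_sym -cat1s perm_catCA.
(* Nestedness, being stated through subsequences, passes to the shortened word. *)
have sub : subseq (r1 ++ r2) s.
  apply: (@subseq_trans _ (l1 ++ l3)).
    by rewrite def_t; apply: cat_subseq => //; apply: subseq_cons.
  rewrite s_def; apply: cat_subseq => //.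
  by apply: subseq_trans (subseq_cons _ _); apply: subseq_cons.
apply/lswordsSP; exists (r1 ++ r2), (size r1), (size l1); split.
- by apply/IH; split=> // a b /subseq_trans/(_ sub)/sLS.
- by rewrite size_cat leq_addr.
- have := congr1 size def_t; rewrite !size_cat /= addnS => <-.
  by rewrite leq_addr.
- have -> : ins [:: q] (r1 ++ r2) (size r1) = l1 ++ l3.
    by rewrite /ins take_size_cat // drop_size_cat.
  by rewrite /ins take_size_cat // drop_size_cat.
Qed.

(** The inserted letters are fresh: filtering them out recovers the word, and the index of [y]
    recovers the position. *)
Lemma uniq_ins (T : eqType) (y : T) x (ws : seq (seq T)) :
    uniq ws -> {in ws, forall s, all (fun a => a \notin y :: x) s} ->
  uniq [seq ins (y :: x) s i | s <- ws, i <- iota 0 (size s).+1].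
Proof.
move=> ws_uniq ws_free.
apply: (@allpairs_uniq_dep _ (fun=> nat)) => // [s _|]; first exact: iota_uniq.
move=> _ _ /allpairsPdep[s [i [sws iis ->]]] /allpairsPdep[t [j [tws jit ->]]] /= eq_st.
have f_ins u k : u \in ws -> [seq a <- ins (y :: x) u k | a \notin y :: x] = u.
  move=> uws; apply: filter_ins (ws_free u uws).
  by apply/allP => a ax /=; rewrite negbK.
have st : s = t by rewrite -(f_ins s i) // eq_st f_ins.
move: eq_st; rewrite -st => /(congr1 (index y)).
have ys : y \notin s by apply/negP => /(allP (ws_free s sws)); rewrite mem_head.
rewrite !mem_iota !ltnS -st in iis jit.
by rewrite !index_ins // => ->.
Qed.

Lemma uniq_lswords n : uniq (lswords n).
Proof.
elim: n => // n IH; apply: uniq_ins; first apply: uniq_ins => //.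
  move=> s /lswords_bound sn; apply/allP => b /sn /andP[_ bn].
  by rewrite /= inE; apply: contraTneq bn => ->; rewrite ltnn.
move=> _ /flatten_mapP[s sls /mapP[i _ ->]]; have sn := lswords_bound sls.
rewrite all_ins /=; apply/allP => b /sn /andP[_ bn].
by rewrite /= !inE orbb; apply: contraTneq bn => ->; rewrite ltnn.
Qed.

(** * Transfer between tuples over ['I_n] and words with natural values *)

Definition to_nletter n (a : letter n) : nletter := (barred a, value a).

Lemma to_nletter_inj n : injective (@to_nletter n).
Proof. by move=> [f k] [g l] [-> /val_inj ->]. Qed.

Lemma perm_letters_iota n :
  perm_eq (flatten [seq [:: (false, k.+1); (false, k.+1); (true, k.+1)]
                   | k <- iota 0 n]) (letters n).
Proof.
elim: n => // n IH.
by rewrite -addn1 iotaD map_cat flatten_cat perm_catC addn1 /= !perm_cons.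
Qed.

Lemma perm_map_Mn n (s : seq (letter n)) :
  perm_eq (map (@to_nletter n) s) (letters n) = perm_eq s (Mn n).
Proof.
have Mn_perm : perm_eq (map (@to_nletter n) (Mn n)) (letters n).
  apply: perm_trans (perm_letters_iota n).
  by rewrite /Mn map_flatten -map_comp -val_enum_ord -map_comp.
apply/idP/idP => [s_perm | /(perm_map (@to_nletter n)) s_perm].
  apply: (perm_map_inj (@to_nletter_inj n)); apply: perm_trans s_perm _.
  by rewrite perm_sym.
exact: perm_trans s_perm Mn_perm.
Qed.

Lemma cons_nth_subseq (T : eqType) (x0 : T) (u s : seq T) i :
  (i < size s)%N -> subseq u (drop i.+1 s) -> subseq (nth x0 s i :: u) s.
Proof.
move=> i_lt sub; rewrite -[X in subseq _ X](cat_take_drop i s) (drop_nth x0) //.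
by apply: subseq_trans (suffix_subseq _ _); rewrite /= eqxx.
Qed.

(** This links [nested] to the condition on positions in [legendre_stirling]. *)
Lemma subseq3P (T : eqType) (x0 a b c : T) (s : seq T) :
  reflect (exists i j k, [/\ (i < j < k)%N, (k < size s)%N &
             [/\ nth x0 s i = a, nth x0 s j = b & nth x0 s k = c]])
          (subseq [:: a; b; c] s).
Proof.
apply: (iffP idP) => [/subseqP[m size_m abc] | [i [j [k [/andP[ij jk] ks [<- <- <-]]]]]].
  have sub : subseq (mask m (iota 0 (size s))) (iota 0 (size s)) by apply: mask_subseq.
  have := congr1 (mask m) (esym (mkseq_nth x0 s)); rewrite -abc /mkseq -map_mask.
  move: sub (subseq_sorted ltn_trans sub (iota_ltn_sorted 0 (size s))).
  case: (mask _ _) => [|i [|j [|k []]]] //= sub /and3P[ij jk _] [ai bj ck].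
  exists i, j, k; split; rewrite ?ij //.
  have : k \in iota 0 (size s) by apply: (mem_subseq sub); rewrite !inE eqxx !orbT.
  by rewrite mem_iota.
have js := ltn_trans jk ks; have nth_after l u : (l < u)%N ->
    nth x0 s u = nth x0 (drop l.+1 s) (u - l.+1) by move=> lu; rewrite nth_drop subnKC.
apply: cons_nth_subseq; first exact: ltn_trans ij js.
rewrite (nth_after i j) //; apply: cons_nth_subseq.
  by rewrite size_drop ltn_sub2r // (leq_ltn_trans ij).
rewrite drop_drop addSn subnK // sub1seq (nth_after j k) // mem_nth //.
by rewrite size_drop ltn_sub2r // (leq_ltn_trans jk).
Qed.

Lemma nth_to_nletter n (p : word n) (i : 'I_(3 * n)) :
  nth sentinel (map (@to_nletter n) p) i = to_nletter (tnth p i).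
Proof. by rewrite (nth_map (tnth p i)) ?size_tuple // -tnth_nth. Qed.

Lemma legendre_stirlingE n (p : word n) :
  legendre_stirling p <-> map (@to_nletter n) p \in lswords n.
Proof.
have iffA (P Q Q' : Prop) : (P -> Q <-> Q') -> P /\ Q <-> P /\ Q' by tauto.
rewrite mem_lswords perm_map_Mn /legendre_stirling -(rwP andP).
apply: iffA => _; symmetry.
split=> [pLS | /forallP pLS a b].
  apply/forallP => i; apply/forallP => j; apply/forallP => k; apply/implyP.
  case/and4P=> ij jk i_unbarred /eqP eq_ik.
  apply: (pLS _ (to_nletter (tnth p j))); apply/(subseq3P sentinel).
  exists i, j, k; rewrite size_map size_tuple ij jk ltn_ord !nth_to_nletter -eq_ik.
  by split; rewrite /to_nletter ?(negPf i_unbarred).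
case/(subseq3P sentinel) => [i [j [k]]]; rewrite size_map size_tuple.
case=> /andP[ij jk] k_lt; have j_lt := ltn_trans jk k_lt; have i_lt := ltn_trans ij j_lt.
rewrite (nth_to_nletter p (Ordinal i_lt)) (nth_to_nletter p (Ordinal j_lt)).
rewrite (nth_to_nletter p (Ordinal k_lt)) => -[pi <- pk].
have {}pk := to_nletter_inj (etrans pk (esym pi)).
have := pLS (Ordinal i_lt) => /forallP/(_ (Ordinal j_lt))/forallP/(_ (Ordinal k_lt)).
case: pi => i_unbarred <-.
by rewrite /= ij jk i_unbarred pk eqxx.
Qed.

Lemma lswords_to_nletter n (s : seq nletter) :
  s \in lswords n -> exists2 p : word n, s = map (@to_nletter n) p & p \in Ln n.
Proof.
(* The inverse map uses [inord], which needs a nonempty ordinal type. *)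
case: n => [|n] sls.
  exists [tuple]; first by apply/eqP; rewrite inE in sls.
  by rewrite inE; apply/legendre_stirlingE.
have s_bound := lswords_bound sls.
have size_s : size s = (3 * n.+1)%N.
  move: sls => /mem_lswords[/perm_size -> _].
  by elim: n.+1 => //= m ->; rewrite mulnS.
pose t : seq (letter n.+1) := [seq (b.1, inord b.2.-1) | b <- s].
have t_s : map (@to_nletter n.+1) t = s.
  rewrite -map_comp map_id_in // => -[f k] /s_bound /= /andP[k0 kn].
  by rewrite /to_nletter /value /= inordK prednK.
have size_t : size t == (3 * n.+1)%N by rewrite size_map size_s.
exists (Tuple size_t); first by rewrite t_s.
by rewrite inE; apply/legendre_stirlingE; rewrite /= t_s.
Qed.

Lemma sum_Ln (V : nmodType) n (G : seq nletter -> V) :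
  \sum_(p in Ln n) G (map (@to_nletter n) p) = \sum_(s <- lswords n) G s.
Proof.
rewrite -big_enum /= -(big_map (fun p : word n => map (@to_nletter n) p) xpredT G).
apply: perm_big; apply: uniq_perm; last 1 first.
- move=> s; apply/mapP/idP => [[p] | /lswords_to_nletter[p -> pL]].
    by rewrite mem_enum inE => /legendre_stirlingE ? ->.
  by exists p; rewrite ?mem_enum.
- rewrite map_inj_uniq ?enum_uniq // => p q /(inj_map (@to_nletter_inj n)).
  exact: val_inj.
- exact: uniq_lswords.
Qed.

(** * Gap labels against the sets X, Y, Z, U and V *)

Lemma nth_gaps w0 a s j : (j <= size s)%N ->
  nth w0 (gaps a s) j =
  gap (nth sentinel (a :: s) j) (nth sentinel s j)
      (nth sentinel s j \in drop j.+1 s).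
Proof.
elim: s a j => [|b s IH] a [|j] //=; first by rewrite drop0.
by move/IH->.
Qed.

Lemma gapE (A : comNzRingType) (c : nat * nat -> A) a b again :
  c (gap a b again) =
  (if (a.2 <= b.2)%N then c ((if b.1 then 3 else if again then 0 else 2)%N, b.2) else 1) *
  (if (b.2 < a.2)%N then c ((if a.1 then 4 else 1)%N, a.2) else 1).
Proof. by rewrite /gap; case: leqP => _; rewrite ?mulr1 ?mul1r. Qed.

(** An ascent factor is charged to the letter right of its gap and a descent factor to the letter on
    the left, which turns a product over gaps into products over positions. *)
Lemma wt_gaps (A : comNzRingType) (c : nat * nat -> A) (s : seq nletter) :
    s != [::] -> all (fun b => 0 < b.2)%N s ->
  let l := nth sentinel s in
  wt c (gaps sentinel s) =
  \prod_(i < size s)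
     (if ((nth sentinel (sentinel :: s) i).2 <= (l i).2)%N
      then c ((if (l i).1 then 3 else if l i \in drop i.+1 s then 0 else 2)%N, (l i).2)
      else 1) *
  \prod_(i < size s)
     (if ((l i.+1).2 < (l i).2)%N then c ((if (l i).1 then 4 else 1)%N, (l i).2)
      else 1).
Proof.
move=> s_neq0 s_gt0 l; rewrite /wt (big_nth (0, 0)%N) big_mkord size_gaps.
under eq_bigr => i _ do rewrite nth_gaps -1?ltnS // gapE.
(* The first gap is no descent, its left value being 0; the last is no ascent, since the last letter
   is positive. *)
rewrite big_split /= big_ord_recr big_ord_recl /= mul1r; congr (_ * _).
rewrite ifN ?mulr1 // -ltnNge [nth _ s _]nth_default //=.
case: s s_neq0 s_gt0 {l} => // b s _ /allP; apply.
exact: (@mem_nth _ sentinel (b :: s) (size s) (ltnSn _)).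
Qed.

Lemma nth_padded n (p : word n) i :
  nth 0%N (padded p) i = (nth sentinel (sentinel :: map (@to_nletter n) p) i).2.
Proof.
case: i => //= i; rewrite nth_rcons size_map.
case: ltngtP => i_lt.
- case: (tval p) i_lt => // a s i_lt.
  by rewrite !(nth_map a).
- by rewrite nth_default // size_map ltnW.
- by rewrite nth_default // size_map i_lt.
Qed.

(** An unbarred letter has two copies in all, so one is the first exactly when another follows. *)
Lemma occurrence_unbarred n (p : word n) (i : 'I_(3 * n)) :
    legendre_stirling p -> ~~ barred (tnth p i) ->
  occurrence p i = (tnth p i \notin drop i.+1 p).+1.
Proof.
case/andP=> p_perm _ i_unbarred; rewrite /occurrence; congr _.+1.
set a := tnth p i in i_unbarred *.
have cnt : count_mem a p = 2%N.
  have -> : count_mem a p = count_mem (to_nletter a) (map (@to_nletter n) p).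
    by rewrite count_map; apply: eq_count => b; rewrite /= (inj_eq (@to_nletter_inj n)).
  rewrite (permP (_ : perm_eq _ (letters n))) ?perm_map_Mn //.
  by rewrite /to_nletter count_letters (negPf i_unbarred) /value ltn_ord.
have i_lt : (i < size p)%N by rewrite size_tuple.
move: cnt; rewrite -{1}(cat_take_drop i p) count_cat (drop_nth a) // -tnth_nth /= eqxx.
rewrite -has_pred1 has_count; set k := count _ (drop _ _).
by case: k => [|k] /=; lia.
Qed.

Lemma meval_prod_var (R : realType) n (z : 'I_(5 * n) -> R[i]) f
    (p : word n) (S : {set 'I_(3 * n)}) :
  (\prod_(i in S) var R f (tnth p i)).@[z]
  = \prod_i (if i \in S then z (mxvec_index f (tnth p i).2) else 1).
Proof.
rewrite rmorph_prod -big_mkcond /=; apply: eq_bigr => i _.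
exact: mevalXU.
Qed.

Theorem theorem5p4 (R : realType) (n : nat) (hn : (1 <= n)%N) :
  stable (Bn R n).
Proof.
case: n hn => // n _ z z_gt0.
(* As [inord] is total, every label, the dummy one included, receives a value of [z], hence one in
   the upper half plane. *)
pose c (w : nat * nat) := z (mxvec_index (inord w.1) (inord w.2.-1)).
suff -> : (Bn R n.+1).@[z] = Fpoly n.+1 c.
  by apply/eqP; case: (@Fpoly_neq0 R n.+1 c) => // w; apply: z_gt0.
have c_letter f (a : letter n.+1) : z (mxvec_index (inord f) a.2) = c (f, value a).
  by rewrite /c /= inord_val.
rewrite /Bn raddf_sum /Fpoly -sum_Ln /=; apply: eq_bigr => p; rewrite inE => pLS.
set s := map _ p.
have sls : s \in lswords n.+1 by apply/legendre_stirlingE.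
have size_s : size s = (3 * n.+1)%N by rewrite size_map size_tuple.
rewrite wt_gaps -?size_eq0 ?size_s //; last first.
  by apply/allP => b /(lswords_bound sls) /andP[].
(* Both sides are now products over positions and are compared factor by factor. *)
rewrite !mevalM !meval_prod_var -!big_split /=; apply: eq_bigr => i _.
rewrite !inE !c_letter /weak_ascent_at /descent_at !nth_padded -/s.
have -> : nth sentinel (sentinel :: s) i.+1 = to_nletter (tnth p i).
  exact: nth_to_nletter.
have -> : nth sentinel (sentinel :: s) i.+2 = nth sentinel s i.+1 by [].
have -> : nth sentinel s i = to_nletter (tnth p i) by exact: nth_to_nletter.
rewrite -map_drop mem_map; last exact: to_nletter_inj.
rewrite {2 4 5}/to_nletter /=.
case: (boolP (barred _)) => [_ | i_unbarred].
  by case: (_ <= _)%N; case: (_ < _)%N => /=; ring.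
rewrite occurrence_unbarred //; case: (_ \in _) => /=.
all: by case: (_ <= _)%N; case: (_ < _)%N => /=; ring.
Qed.
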